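(* Suppose $G=(V,E)$ is a path. Let $z^P$ be the $S$-labeling number $SL_\phi(G)$ of a labeling $\phi$ obtained by the path algorithm, and let $z^D$ be the objective value in the dual problem $(D_{F2})$ of the dual solution obtained by the dual heuristic. Then $z^P=z^D$.
   Context: For a graph $G=(V,E)$ and a labeling (bijection) $\phi:V\to\{1,\ldots,|V|\}$, the $S$-labeling number with respect to $\phi$ is $SL_\phi(G)=\sum_{\{u,v\}\in E}\min\{\phi(u),\phi(v)\}$. Dual problem $(D_{F2})$: with real variables $\alpha_k$ ($k\in\{1,\ldots,|V|\}$), $\beta_i$ ($i\in V$), $\gamma_e$ ($e\in E$), $\delta^k_e$ ($e\in E$, $k\in\{1,\ldots,|V|\}$), maximize $\sum_k\alpha_k+\sum_{i\in V}\beta_i+\sum_{e\in E}\gamma_e$ subject to $\alpha_k+\beta_i+\sum_{e\in E:\,i\in e}\delta^k_e\le 0$ for all $k$ and all $i\in V$; $\gamma_e-\delta^k_e\le k$ for all $e\in E$ and all $k$; $\delta^k_e\ge0$ for all $e\in E$ and all $k$. (This is the LP dual of the LP-relaxation of the formulation (F2): minimize $\sum_{e}\sum_k k\,d^k_e$ subject to $\sum_i x^k_i=1$ for all $k$, $\sum_k x^k_i=1$ for all $i$, $\sum_k d^k_e=1$ for all $e\in E$, $d^k_e\le x^k_i+x^k_{i'}$ for all $k$ and $e=\{i,i'\}\in E$, with all variables $x^k_i,d^k_e$ binary.) Dual heuristic: start with $\alpha=0$, $\beta=0$, $\delta=0$ and $\gamma_e=1$ for all $e\in E$ (objective value $|E|$);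 let $\Delta$ be the maximum degree of a node of $G$. For $\bar k=1,2,\ldots,|V|$ in this order: if $|E|-\bar k\cdot\Delta>0$, then for each $k\le\bar k$ decrease $\alpha_k$ by $\Delta$ and increase $\delta^k_e$ by $1$ for all $e\in E$, and increase $\gamma_e$ by $1$ for all $e\in E$ (so the objective value changes by $|E|-\bar k\cdot\Delta$); otherwise stop. The output is the final $(\alpha,\beta,\gamma,\delta)$. Path algorithm: number the nodes of the path $1,2,\ldots,|V|$ consecutively starting from one end; going along the path in this order, label each even-numbered node with the smallest unused label (so node $2j$ gets label $j$); then label the odd-numbered nodes arbitrarily with the remaining labels. *)

(* Defs.v *)
From mathcomp Require Import all_boot all_order all_algebra.

Set Implicit Arguments.
Unset Strict Implicit.
Unset Printing Implicit Defensive.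

Import Order.TTheory GRing.Theory Num.Theory.
Local Open Scope ring_scope.

Section Graphs.
Variable V : finType.
Implicit Types (E : {set {set V}}) (s t : seq V) (phi : V -> 'I_#|V|).

(* A finite simple graph (V, E) is given by its set E of two-element edges. *)
Definition simple_graph E : Prop := forall e, e \in E -> #|e| = 2%N.

Definition degree E (v : V) : nat := #|[set e in E | v \in e]|.

Definition max_degree E : nat := (\max_(v : V) degree E v)%N.

(* Labels {1, ..., |V|} are represented by 'I_#|V|: the element k : 'I_#|V|
   stands for the label k + 1. *)
Definition label_val (k : 'I_#|V|) : nat := k.+1.

(* The default value #|V| of the inner minimum never matters on an edge, as no
   label exceeds it. *)
Definition SL E phi : nat :=
  (\sum_(e in E) \big[minn/#|V|]_(v in e) label_val (phi v))%N.

Definition path_numbering E s : Prop :=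
  [/\ s <> [::], uniq s, forall v, v \in s
    & E = [set [set p.1; p.2] | p in zip s (behead s)]].

Definition is_path E : Prop := exists s, path_numbering E s.

(* With s = [:: s_1; s_2; ...] this is [:: s_2; s_4; ...]. *)
Fixpoint even_nodes s : seq V :=
  if s is _ :: y :: s' then y :: even_nodes s' else [::].

Definition smallest_unused (used : seq 'I_#|V|) (k : 'I_#|V|) : Prop :=
  k \notin used /\ forall m : 'I_#|V|, m \notin used -> (k <= m)%N.

(* phi labels the nodes of t, in this order, each with the smallest label not
   used so far. *)
Fixpoint greedy_labeling phi (used : seq 'I_#|V|) t : Prop :=
  if t is v :: t' then
    smallest_unused used (phi v) /\ greedy_labeling phi (phi v :: used) t'
  else True.

(* Bijectivity is all that is asked of the labels of the odd-numbered nodes: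
   they get the remaining labels, in an arbitrary way. *)
Definition path_algorithm_labeling E phi : Prop :=
  bijective phi /\
  exists2 s, path_numbering E s & greedy_labeling phi [::] (even_nodes s).

End Graphs.

Section Dual.
Variables (R : realFieldType) (V : finType).
Implicit Type E : {set {set V}}.

(* gamma and delta are total on {set V}; only their values on edges matter. *)
Record dual_vars := DualVars {
  alpha : 'I_#|V| -> R;
  beta : V -> R;
  gamma : {set V} -> R;
  delta : 'I_#|V| -> {set V} -> R }.

Definition dual_objective E (y : dual_vars) : R :=
  \sum_k alpha y k + \sum_i beta y i + \sum_(e in E) gamma y e.

Definition dual_feasible E (y : dual_vars) : Prop :=
  [/\ forall k i,
        alpha y k + beta y i + \sum_(e in E | i \in e) delta y k e <= 0,
      forall k e, e \in E -> gamma y e - delta y k e <= (label_val k)%:R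
    & forall k e, e \in E -> 0 <= delta y k e].

Definition dual_start : dual_vars :=
  DualVars (fun=> 0) (fun=> 0) (fun=> 1) (fun _ _ => 0).

Definition dual_step E (kbar : 'I_#|V|) (y : dual_vars) : dual_vars :=
  DualVars
    (fun k => if (k <= kbar)%N then alpha y k - (max_degree E)%:R
              else alpha y k)
    (beta y)
    (fun e => gamma y e + 1)
    (fun k e => if (k <= kbar)%N then delta y k e + 1 else delta y k e).

Fixpoint dual_loop E (ks : seq 'I_#|V|) (y : dual_vars) : dual_vars :=
  if ks is kbar :: ks' then
    if (0 : R) < #|E|%:R - (label_val kbar)%:R * (max_degree E)%:R
    then dual_loop E ks' (dual_step E kbar y)
    else y
  else y.

(* enum 'I_#|V| lists the labels in increasing order. *)
Definition dual_heuristic E : dual_vars :=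
  dual_loop E (enum 'I_#|V|) dual_start.

Lemma dual_heuristic_feasible E : dual_feasible E (dual_heuristic E).
Proof.
pose inv (m : nat) (y : dual_vars) :=
  [/\ forall k e, delta y k e = (m - k)%:R,
      forall k, alpha y k = - ((m - k) * max_degree E)%:R,
      forall i, beta y i = 0 & forall e, gamma y e = m.+1%:R].
have feas m y : inv m y -> dual_feasible E y.
  case=> hd ha hb hg; split=> [k i|k e _|k e _]; last by rewrite hd ler0n.
    rewrite ha hb addr0 addrC subr_le0.
    under eq_bigr do rewrite hd.
    rewrite sumr_const -mulrnA ler_nat leq_mul2l; apply/orP; right.
    have -> : #|[pred e in E | i \in e]| = degree E i.
      by rewrite /degree cardsE.
    exact: (leq_bigmax (F := degree E)).
  rewrite hg hd lerBlDr -natrD ler_nat /label_val addSn ltnS.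
  by rewrite -leq_subLR.
rewrite /dual_heuristic.
have : inv 0%N dual_start.
  by split=> //= *; rewrite sub0n ?mul0n ?oppr0.
have : [seq val k | k <- enum 'I_#|V|] = iota 0 (size (enum 'I_#|V|)).
  by rewrite val_enum_ord size_enum_ord.
move: (enum _) dual_start 0%N; elim=> [|kb ks IH] y m /=.
  by move=> _; apply: feas.
case=> hm hks iy; case: ifP => _; last exact: feas iy.
apply: IH hks _; case: iy => hd ha hb hg.
split=> [k e|k|i|e] /=; rewrite ?hd ?ha ?hb ?hg -?natr1 //.
  rewrite -hm; case: leqP => hk; first by rewrite natr1 -subSn.
  by congr _%:R; transitivity 0%N; [|symmetry]; apply/eqP; rewrite subn_eq0 // ltnW.
rewrite -hm; case: leqP => hk; first by rewrite subSn // mulSn natrD opprD addrC.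
congr (- (_ * _)%:R).
by transitivity 0%N; [|symmetry]; apply/eqP; rewrite subn_eq0 // ltnW.
Qed.

End Dual.

(* Main.v *)
(** Write m = |V| - 1 for the number of edges.  The even-numbered nodes receive
    the labels 1, ..., floor(|V|/2), below all labels of odd-numbered nodes, so
    the i-th edge of the path costs ceil(i/2).  On the dual side the heuristic
    collects m + (m - 2) + (m - 4) + ... down to the last positive term.  Both
    quantities grow by m + 2 when m is replaced by m + 2. *)

From HB Require Import structures.
Require Import Defs.
From mathcomp Require Import all_boot all_order all_algebra.
From mathcomp Require Import zify.

Set Implicit Arguments.
Unset Strict Implicit.
Unset Printing Implicit Defensive.

Import Order.TTheory GRing.Theory Num.Theory.
Local Open Scope ring_scope.

HB.instance Definition _ := SemiGroup.isComLaw.Build nat minn minnA minnC.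

Lemma bigminn_set2 (T : finType) (x y : T) (d : nat) (F : T -> nat) :
  x != y -> \big[minn/d]_(v in [set x; y]) F v = minn (F x) (minn (F y) d).
Proof.
move=> xy; rewrite (eq_bigl (mem [:: x; y])) => [|v]; last by rewrite !inE.
by rewrite -big_uniq /= ?inE ?xy // !big_cons big_nil.
Qed.

Section Paths.
Variable V : finType.
Implicit Types (E : {set {set V}}) (s t : seq V) (phi : V -> 'I_#|V|).

Definition path_edges s : seq {set V} :=
  [seq [set p.1; p.2] | p <- zip s (behead s)].

Lemma size_path_edges s : size (path_edges s) = (size s).-1.
Proof. by rewrite size_map size_zip size_behead; lia. Qed.

Lemma mem_path_edges s (v : V) e : e \in path_edges s -> v \in e -> v \in s.
Proof.
elim: s => [|x [|y s] IH] //.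
rewrite /path_edges /= -/(path_edges (y :: s)) in_cons.
case/predU1P=> [-> /set2P[] ->|/IH/[apply]]; rewrite !inE ?eqxx ?orbT //.
by move=> ->; rewrite orbT.
Qed.

Lemma uniq_path_edges s : uniq s -> uniq (path_edges s).
Proof.
elim: s => [|x [|y s] IH] // /andP[xs us].
rewrite /path_edges /= -/(path_edges (y :: s)) IH // andbT.
by apply: contra xs => /mem_path_edges; apply; rewrite set21.
Qed.

Lemma path_numberingE E s :
  path_numbering E s -> E = [set e in path_edges s].
Proof.
case=> _ _ _ ->; apply/setP=> e; rewrite inE.
by apply/imsetP/mapP=> -[p pz ->]; exists p.
Qed.

Lemma size_path_numbering E s : path_numbering E s -> size s = #|V|.
Proof.
by case=> _ us sV _; rewrite -(card_uniqP us); apply: eq_card => v; rewrite sV.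
Qed.

Lemma card_path E s : path_numbering E s -> #|E| = #|V|.-1.
Proof.
move=> Es; rewrite (path_numberingE Es) cardsE.
case: (Es) => _ us _ _; rewrite (card_uniqP (uniq_path_edges us)).
by rewrite size_path_edges (size_path_numbering Es).
Qed.

Lemma degree_path E s v :
  path_numbering E s ->
  degree E v = count (fun e : {set V} => v \in e) (path_edges s).
Proof.
move=> Es; case: (Es) => _ us _ _; rewrite -size_filter.
rewrite -(card_uniqP (filter_uniq _ (uniq_path_edges us))) /degree cardsE.
apply: eq_card => e.
by rewrite (path_numberingE Es) unfold_in /= inE mem_filter andbC.
Qed.

Lemma count_path_edges_le v s :
  (count (fun e : {set V} => v \in e) (path_edges s)
     <= count_mem v s + count_mem v (behead s))%N.
Proof.
elim: s => [|x [|y s] IH] //.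
rewrite /path_edges /= -/(path_edges (y :: s)) in_set2 (eq_sym v x) (eq_sym v y).
by move: IH => /=; case: (x == v); case: (y == v) => /=; lia.
Qed.

Lemma max_degree_path E s :
  path_numbering E s -> max_degree E = minn 2 #|V|.-1.
Proof.
move=> Es; case: (Es) => s0 us sV _; apply/eqP; rewrite eqn_leq; apply/andP.
split.
  apply/bigmax_leqP => v _; rewrite leq_min; apply/andP; split.
    rewrite (degree_path v Es); apply: leq_trans (count_path_edges_le v s) _.
    case: s us {Es s0 sV} => [|x s] // ux; rewrite [behead _]/=.
    rewrite !count_uniq_mem //; last by case/andP: ux.
    by case: (_ \in _); case: (_ \in _).
  rewrite -(card_path Es); apply: subset_leq_card.
  by apply/subsetP=> e; rewrite inE => /andP[].
case: s s0 us sV Es => [|x [|y s]] // _ us sV Es.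
  by rewrite -(size_path_numbering Es) minn0.
apply: leq_trans (leq_bigmax (F := degree E) y).
rewrite (degree_path y Es) -(size_path_numbering Es).
by case: s {us sV Es} => [|z s]; rewrite /path_edges /= !inE eqxx ?orbT /=; lia.
Qed.

Lemma nth_even_nodes x0 s i : nth x0 (even_nodes s) i = nth x0 s i.*2.+1.
Proof.
have [n] := ubnP (size s); elim: n s i => // n IH [|x [|y s]] [|i] //= sn.
by apply: IH; lia.
Qed.

Lemma size_even_nodes s : size (even_nodes s) = (size s)./2.
Proof.
have [n] := ubnP (size s); elim: n s => // n IH [|x [|y s]] //= sn.
by rewrite IH //; lia.
Qed.

Lemma greedy_labeling_nth phi x0 used (c : nat) t i :
  (forall k : 'I_#|V|, (k \in used) = (k < c)%N) ->
  greedy_labeling phi used t -> (i < size t)%N ->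
  phi (nth x0 t i) = (c + i)%N :> nat.
Proof.
elim: t used c i => [|v t IH] used c i //= usedE [[fresh least] gt].
have phiv : phi v = c :> nat.
  move: fresh; rewrite usedE -leqNgt => cv.
  have cV : (c < #|V|)%N := leq_ltn_trans cv (ltn_ord _).
  by apply/eqP; rewrite eqn_leq cv (least (Ordinal cV)) // usedE ltnn.
case: i => [|i] /=; first by rewrite addn0.
rewrite ltnS addnS -addSn; apply: IH gt => k.
by rewrite in_cons usedE -val_eqE /= phiv [in RHS]ltnS [in RHS]leq_eqVlt.
Qed.

Lemma SL_path E s phi :
  path_numbering E s ->
  SL E phi = (\sum_(p <- zip s (behead s))
                minn (label_val (phi p.1)) (label_val (phi p.2)))%N.
Proof.
move=> Es; case: (Es) => _ us _ _.
rewrite /SL (path_numberingE Es).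
under eq_bigl do rewrite inE.
rewrite -big_uniq ?uniq_path_edges // big_map.
elim: s us {Es} => [|x [|y s] IH] /= us; [by rewrite !big_nil..|].
rewrite !big_cons /= IH; last by case/andP: us.
congr (_ + _)%N; rewrite bigminn_set2; last first.
  by apply: contraTneq us => ->; rewrite mem_head.
by rewrite (minn_idPl (_ : label_val (phi y) <= _)%N) // /label_val ltn_ord.
Qed.

Lemma SL_path_algorithm E phi :
  path_algorithm_labeling E phi ->
  SL E phi = (\sum_(0 <= i < #|V|.-1) i./2.+1)%N.
Proof.
case=> /bij_inj phi_inj [s Es gs]; rewrite (SL_path phi Es).
have sV := size_path_numbering Es; case: (Es) => s0 us _ _.
have [x0 _] : exists x0 : V, True by case: s s0 {Es gs sV us} => // x; exists x.
have even_label i : (i < #|V|./2)%N -> phi (nth x0 s i.*2.+1) = i :> nat.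
  rewrite -nth_even_nodes -{1}sV -size_even_nodes => it.
  by rewrite (greedy_labeling_nth x0 (c := 0%N) _ gs it) // => k; rewrite ltn0.
have odd_label i : (i.*2 < #|V|)%N -> (#|V|./2 <= phi (nth x0 s i.*2))%N.
  move=> si; rewrite leqNgt; apply/negP=> small.
  have /val_inj/phi_inj/eqP := even_label _ small.
  by rewrite nth_uniq ?sV //; lia.
have zs : size (zip s (behead s)) = #|V|.-1.
  by rewrite size_zip size_behead; lia.
rewrite (big_nth (x0, x0)) zs; apply: eq_big_nat => i /andP[_ ilt].
rewrite nth_zip_cond zs ilt /= nth_behead /label_val.
have [oi|ei] := boolP (odd i).
  have iE : i = i./2.*2.+1 by lia.
  have /even_label : (i./2 < #|V|./2)%N by lia.
  have /odd_label : (i./2.+1.*2 < #|V|)%N by lia.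
  by rewrite doubleS -iE; lia.
have iE : i = i./2.*2 by lia.
have /even_label : (i./2 < #|V|./2)%N by lia.
have /odd_label : (i./2.*2 < #|V|)%N by lia.
by rewrite -iE; lia.
Qed.

End Paths.

Section DualHeuristic.
Variables (R : realFieldType) (V : finType) (E : {set {set V}}).

Lemma dual_objective_step (kbar : 'I_#|V|) (y : dual_vars R V) :
  dual_objective E (dual_step E kbar y) =
  dual_objective E y + (#|E|%:R - (label_val kbar)%:R * (max_degree E)%:R).
Proof.
rewrite /dual_objective /=.
have -> : \sum_(k : 'I_#|V|) (if (k <= kbar)%N then alpha y k - (max_degree E)%:R
                  else alpha y k)
          = \sum_k alpha y k - (label_val kbar)%:R * (max_degree E)%:R.
  rewrite (eq_bigr (fun k : 'I_#|V| => alpha y k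
             + (if (k <= kbar)%N then - (max_degree E)%:R else 0))); last first.
    by move=> k _; case: ifP; rewrite ?addr0.
  rewrite big_split /= -big_mkcond sumr_const; congr (_ + _).
  have -> : #|[pred k : 'I_#|V| | (k <= kbar)%N]| = label_val kbar.
    rewrite /label_val -sum1_card -(card_ord kbar.+1) -[in RHS]sum1_card.
    by rewrite (big_ord_widen _ (fun=> 1%N) (ltn_ord kbar)).
  by rewrite mulNrn mulr_natl.
rewrite big_split /= sumr_const.
by rewrite (addrAC _ (- _)) addrACA (addrC (- _)).
Qed.

(* Truncated subtraction makes the terms after the stopping point vanish. *)
Lemma dual_objective_loop (ks : seq 'I_#|V|) (y : dual_vars R V) :
  sorted (fun j k : 'I_#|V| => j <= k)%N ks ->
  dual_objective E (dual_loop E ks y) =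
  dual_objective E y
    + (\sum_(k <- ks) (#|E| - label_val k * max_degree E))%N%:R.
Proof.
elim: ks y => [|kbar ks IH] y ks_sorted; first by rewrite big_nil addr0.
rewrite [dual_loop _ _ _]/= subr_gt0 -natrM ltr_nat; case: ltnP => [lt|ge].
  rewrite IH ?(path_sorted ks_sorted) // dual_objective_step big_cons natrD.
  by rewrite natrB 1?ltnW // natrM -!addrA.
rewrite big_seq big1 ?addr0 // => k kks; apply/eqP; rewrite subn_eq0.
apply: leq_trans ge _; rewrite leq_mul2r; apply/orP; right.
have le_trans3 : transitive (fun j k : 'I_#|V| => j <= k)%N.
  by move=> a b c; apply: leq_trans.
move: kks; rewrite in_cons => /orP[/eqP->//|].
by move: (order_path_min le_trans3 ks_sorted) => /allP/[apply]; rewrite ltnS.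
Qed.

Lemma dual_objective_heuristic :
  dual_objective E (dual_heuristic R E) =
  (\sum_(0 <= k < #|V|.+1) (#|E| - k * max_degree E))%N%:R.
Proof.
rewrite dual_objective_loop; last first.
  by have := iota_sorted 0 #|V|; rewrite -val_enum_ord sorted_map.
rewrite /dual_objective /= !big1_eq !add0r sumr_const -natrD.
by rewrite big_enum /= big_nat_recl // mul0n subn0 big_mkord.
Qed.

End DualHeuristic.

Lemma sum_half_succ (m n : nat) : (m <= n)%N ->
  (\sum_(0 <= i < m) i./2.+1 = \sum_(0 <= k < n) (m - k * 2))%N.
Proof.
have [b] := ubnP m; elim: b m n => // b IH [|[|m]] [|n] // mb mn.
- by rewrite !big_nil.
- by rewrite big_nil big1 // => i _; rewrite sub0n.
- by rewrite big_nat1 big_nat_recl // big1 // => i _; lia.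
rewrite 2?[in LHS]big_nat_recr //= (IH m n) //; [|lia..].
rewrite [in RHS]big_nat_recl //.
rewrite [in RHS](eq_bigr (fun k => m - k * 2)%N) => [|k _]; lia.
Qed.

Theorem theorem2 (R : realFieldType) (V : finType) (E : {set {set V}})
    (phi : V -> 'I_#|V|) :
  simple_graph E -> is_path E ->
  path_algorithm_labeling E phi ->
  (SL E phi)%:R = dual_objective E (dual_heuristic R E).
Proof.
move=> _ [s Es] phiP.
rewrite (SL_path_algorithm phiP) dual_objective_heuristic.
rewrite (card_path Es) (max_degree_path Es) (sum_half_succ (n := #|V|.+1)); last lia.
congr _%:R; apply: eq_bigr => k _.
(* The degree is below 2 only for at most one edge, where only the term of
   index 0 counts. *)
by case: #|V|.-1 => [|[|m]] //; case: k => [|k]; lia.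
Qed.
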